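(* For every $n>0$, the canonical join complex of the Hochschild lattice $\mathrm{Hoch}(n)$ is vertex decomposable.
   Context: Hochschild lattice. For $n\geq 1$, a triword of length $n$ is a tuple $u=(u_1,\ldots,u_n)$ such that (T1) $u_i\in\{0,1,2\}$ for all $i$; (T2) $u_1\neq 2$; (T3) if $u_i=0$, then $u_j\neq 1$ for all $j>i$. Let $\mathrm{Tri}(n)$ be the set of all triwords of length $n$. The Hochschild lattice is $\mathrm{Hoch}(n)=(\mathrm{Tri}(n),\leq)$ where $\leq$ is the componentwise order. It is known to be a lattice: the join is the componentwise maximum, and the meet is obtained by taking the componentwise minimum and then replacing by $0$ every entry $1$ that has an entry $0$ somewhere to its left. Canonical join complex. Let $L$ be a finite lattice. A join representation of $a\in L$ is a subset $A\subseteq L$ with $\bigvee A=a$ (the empty join is $\hat 0$). For join representations $A_1,A_2$ of $a$, $A_1$ refines $A_2$ if for every $a_1\in A_1$ there is $a_2\in A_2$ with $a_1\leq a_2$. The canonical join representation of $a$ (if it exists) is the antichain which is a join representation of $a$ and refines every join representation of $a$; it consists of join-irreducible elements. It is known that in $\mathrm{Hoch}(n)$ every element has a canonical join representation, and that every subset of a canonical join representation is again a canonical join representation. The canonical join complex of $L$ is the simplicial complex whose vertices are the join-irreducible elements of $L$ and whose faces are the canonical join representations of elements of $L$. Vertex decomposability (not necessarily pure). For a simplicial complex $\Delta$ and a vertex $v$, let $\mathrm{link}_\Delta(v)=\{G\in\Delta\mid v\notin G,\ G\cup\{v\}\in\Delta\}$ and $\mathrm{del}_\Delta(v)=\{G\in\Delta\mid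 v\notin G\}$. Facets are inclusion-maximal faces, and a simplex is a complex with a unique facet. $\Delta$ is vertex decomposable if either $\Delta$ is a simplex, or there exists a vertex $v$ of $\Delta$ such that (VD1) $\mathrm{link}_\Delta(v)$ is vertex decomposable, (VD2) $\mathrm{del}_\Delta(v)$ is vertex decomposable, and (VD3) no facet of $\mathrm{link}_\Delta(v)$ is a facet of $\mathrm{del}_\Delta(v)$. *)

(* Defs.v *)
From HB Require Import structures.
From mathcomp Require Import all_boot all_order.

Set Implicit Arguments.
Unset Strict Implicit.
Unset Printing Implicit Defensive.

Import Order.TTheory.

(* A simplicial complex is given by its set of faces; its vertices are the
   [v] such that [[set v]] is a face, so elements of the ambient type [T] that
   are in no face play no role. *)
Section SimplicialComplex.
Variable T : finType.
Implicit Types (D : {set {set T}}) (F G : {set T}) (v : T).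

Definition simplicial_complex D : Prop :=
  D != set0 /\ (forall F G, F \in D -> G \subset F -> G \in D).

Definition vertex D v : bool := [set v] \in D.

Definition link D v : {set {set T}} :=
  [set G : {set T} in D | (v \notin G) && (v |: G \in D)].

Definition del D v : {set {set T}} := [set G : {set T} in D | v \notin G].

Definition facet D F : bool := maxset (mem D) F.

(* The complex [[set set0]] is a simplex (of dimension -1). *)
Definition simplex D : Prop := exists! F, facet D F.

Inductive vertex_decomposable : {set {set T}} -> Prop :=
| VD_simplex D : simplex D -> vertex_decomposable D
| VD_shedding D v :
    vertex D v ->
    vertex_decomposable (link D v) ->
    vertex_decomposable (del D v) ->
    (forall F, facet (link D v) F -> ~~ facet (del D v) F) ->
    vertex_decomposable D.

Lemma linkE D v : simplicial_complex D ->
  link D v = [set G : {set T} | (v \notin G) && (v |: G \in D)].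
Proof.
move=> [_ Dsub]; apply/setP=> G; rewrite !inE.
by case: (boolP (v |: G \in D)) => [/Dsub/(_ (subsetUr _ _))->|]; rewrite ?andbF.
Qed.

Lemma simplicial_complex_link D v :
  simplicial_complex D -> vertex D v -> simplicial_complex (link D v).
Proof.
move=> Dcx vD; rewrite linkE //; case: Dcx => _ Dsub; split=> [|F G].
  by apply/set0Pn; exists set0; rewrite inE in_set0 setU0.
rewrite !inE => /andP[vF vFD] sGF; apply/andP; split.
  by apply: contra vF; apply: (subsetP sGF).
by apply: Dsub vFD _; apply: setUS.
Qed.

Lemma simplicial_complex_del D v :
  simplicial_complex D -> simplicial_complex (del D v).
Proof.
move=> [/set0Pn[F0 F0D] Dsub]; split=> [|F G].
  by apply/set0Pn; exists set0; rewrite !inE andbT (Dsub F0) ?sub0set.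
rewrite !inE => /andP[FD vF] sGF; rewrite (Dsub F) //=.
by apply: contra vF; apply: (subsetP sGF).
Qed.

End SimplicialComplex.

Section CanonicalJoinComplex.
Context {d : Order.disp_t} {L : finTBLatticeType d}.
Implicit Types (A B : {set L}) (a x y z : L).
Local Open Scope order_scope.

Definition join_representation A a : bool := \join_(x in A) x == a.

Definition refines A B : bool := [forall x in A, exists y in B, x <= y].

Definition antichain A : bool :=
  [forall x in A, forall y in A, (x <= y) ==> (x == y)].

Definition canonical_join_representation A a : bool :=
  [&& antichain A, join_representation A a
    & [forall B, join_representation B a ==> refines A B]].

Definition join_irreducible x : bool :=
  (x != \bot) && [forall y, forall z, (x == y `|` z) ==> (x == y) || (x == z)].

Definition canonical_join_complex : {set {set L}} :=
  [set A | [exists a, canonical_join_representation A a]].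

Lemma antichainP A :
  reflect {in A &, forall x y, x <= y -> x = y} (antichain A).
Proof.
apply: (iffP forall_inP) => [H x y xA yA xy|H x xA].
  by move/forall_inP: (H x xA) => /(_ y yA)/implyP/(_ xy)/eqP.
by apply/forall_inP=> y yA; apply/implyP=> xy; apply/eqP/H.
Qed.

Lemma refinesP A B :
  reflect (forall x, x \in A -> exists2 y, y \in B & x <= y) (refines A B).
Proof.
apply: (iffP forall_inP) => H x xA; first exact/exists_inP/H.
by apply/exists_inP/H.
Qed.

Lemma canonical_join_representationP A a :
  reflect [/\ antichain A, join_representation A a
            & forall B, join_representation B a -> refines A B]
          (canonical_join_representation A a).
Proof.
apply: (iffP and3P) => -[AA Aa H]; split=> //.
  by move=> B Ba; move/forallP: H => /(_ B)/implyP/(_ Ba).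
by apply/forallP=> B; apply/implyP/H.
Qed.

Lemma canonical_join_representation_uniq A B a :
  canonical_join_representation A a -> canonical_join_representation B a ->
  A = B.
Proof.
suff S A' B' : canonical_join_representation A' a ->
    canonical_join_representation B' a -> A' \subset B'.
  by move=> HA HB; apply/eqP; rewrite eqEsubset !S.
move=> /canonical_join_representationP[/antichainP AA Aa HA].
move=> /canonical_join_representationP[_ Ba HB].
apply/subsetP=> x xA; have /refinesP/(_ x xA)[y yB xy] := HA _ Ba.
have /refinesP/(_ y yB)[z zA yz] := HB _ Aa.
have xz : x = z by apply: AA => //; apply: le_trans yz.
by rewrite (@le_anti _ _ x y) // xy xz yz.
Qed.

Lemma canonical_join_complexS A B :
  A \in canonical_join_complex -> B \subset A -> B \in canonical_join_complex.
Proof.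
rewrite !inE => /existsP[a /canonical_join_representationP[/antichainP AA]].
move=> /eqP Aa HA sBA; apply/existsP; exists (\join_(x in B) x).
apply/canonical_join_representationP; split; rewrite /join_representation //.
  by apply/antichainP=> x y xB yB; apply: AA; apply: (subsetP sBA).
move=> C /eqP Cb; apply/refinesP=> x xB.
have xA : x \in A by apply: (subsetP sBA).
have /HA/refinesP/(_ x xA)[y] : join_representation (C :|: A :\: B) a.
  have BUD : B :|: A :\: B = A.
    by rewrite setDE setUIr setUCr setIT; apply/setUidPr.
  by rewrite /join_representation joins_setU Cb -joins_setU BUD Aa.
rewrite !inE => /orP[yC xy|/andP[yB yA] xy]; first by exists y.
by rewrite -(AA x y xA yA xy) xB in yB.
Qed.

Lemma simplicial_complex_canonical_join :
  simplicial_complex canonical_join_complex.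
Proof.
split; last exact: canonical_join_complexS.
apply/set0Pn; exists set0; rewrite inE; apply/existsP; exists \bot.
apply/canonical_join_representationP; split.
- by apply/antichainP=> x y; rewrite inE.
- by rewrite /join_representation big_set0.
- by move=> B _; apply/refinesP=> x; rewrite inE.
Qed.

Lemma vertex_canonical_join_complex x :
  vertex canonical_join_complex x = join_irreducible x.
Proof.
rewrite /vertex inE; apply/existsP/andP => [[a]|[x0 /forallP xI]].
  move=> /canonical_join_representationP[_ /eqP]; rewrite big_set1 => <- H.
  split.
    apply/eqP=> x0; have /H/refinesP/(_ x) : join_representation set0 x.
      by rewrite /join_representation big_set0 x0.
    by rewrite set11 => /(_ isT)[y]; rewrite inE.
  apply/forallP=> y; apply/forallP=> z; apply/implyP=> /eqP xyz.
  have /H/refinesP/(_ x) : join_representation [set y; z] x.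
    by rewrite /join_representation joins_setU !big_set1 -xyz.
  rewrite set11 => /(_ isT)[t]; rewrite !inE => /orP[]/eqP-> xt.
    by rewrite eq_le xt xyz leUl.
  by rewrite orbC eq_le xt xyz leUr.
exists x; apply/canonical_join_representationP; split.
- by apply/antichainP=> y z /set1P-> /set1P->.
- by rewrite /join_representation big_set1.
move=> B /eqP Bx; apply/refinesP=> y /set1P->; exists x => //; move: Bx x0 xI.
rewrite -big_enum -[x \in B]mem_enum; move: (enum B) x => s.
elim: s => [|b s IHs] x; first by rewrite big_nil => ->; rewrite eqxx.
rewrite big_cons inE => xE x0 xI.
move: (xI b) => /forallP/(_ (\join_(i <- s) i)).
rewrite {1}xE eqxx /= => /orP[->//|/eqP/esym sx].
by rewrite IHs ?orbT.
Qed.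

End CanonicalJoinComplex.

Arguments canonical_join_complex {d} L.

(* Positions are numbered from 0, so the first letter is the one at the index
   [i : 'I_n] of value 0. *)
Definition is_triword n (u : {ffun 'I_n -> 'I_3}) : bool :=
  [forall i : 'I_n, (i == 0 :> nat) ==> (u i != 2 :> nat)] &&
  [forall i : 'I_n, forall j : 'I_n, ((u i == 0 :> nat) && (i < j)) ==> (u j != 1 :> nat)].

Record triword (n : nat) : Type := Triword {
  triword_val :> {ffun 'I_n -> 'I_3};
  triwordP : is_triword triword_val
}.

HB.instance Definition _ n := [isSub for @triword_val n].
HB.instance Definition _ n := [Finite of triword n by <:].

Section Hochschild.
Variable n : nat.
Implicit Types (u v w : triword n) (f g : {ffun 'I_n -> 'I_3}) (i j : 'I_n).

Lemma is_triwordP f :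
  reflect ((forall i, i = 0 :> nat -> f i <> 2 :> nat) /\
           (forall i j, f i = 0 :> nat -> i < j -> f j <> 1 :> nat))
          (is_triword f).
Proof.
apply: (iffP andP) => -[H1 H2]; split.
- by move=> i i0; apply/eqP; move/forallP/(_ i)/implyP: H1; apply; apply/eqP.
- move=> i j fi ij; apply/eqP; move/forallP/(_ i)/forallP/(_ j)/implyP: H2.
  by apply; rewrite fi ij.
- by apply/forallP=> i; apply/implyP=> /eqP/H1/eqP.
- apply/forallP=> i; apply/forallP=> j; apply/implyP=> /andP[/eqP fi ij].
  exact/eqP/(H2 i).
Qed.

Definition tri_le u v : bool := [forall i, u i <= v i].

Lemma tri_leP u v : reflect (forall i, u i <= v i) (tri_le u v).
Proof. exact: forallP. Qed.

Lemma tri_le_refl : reflexive tri_le.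
Proof. by move=> u; apply/tri_leP. Qed.

Lemma tri_le_anti : antisymmetric tri_le.
Proof.
move=> u v /andP[/tri_leP uv /tri_leP vu]; apply/val_inj/ffunP=> i.
by apply/val_inj/eqP; rewrite eqn_leq uv vu.
Qed.

Lemma tri_le_trans : transitive tri_le.
Proof.
move=> v u w /tri_leP uv /tri_leP vw; apply/tri_leP=> i.
exact: leq_trans (uv i) (vw i).
Qed.

Fact triword_display : Order.disp_t. Proof. exact: Order.Disp tt tt. Qed.

HB.instance Definition _ :=
  Order.Le_isPOrder.Build triword_display (triword n)
    tri_le_refl tri_le_anti tri_le_trans.

Definition join_fun f g : {ffun 'I_n -> 'I_3} :=
  [ffun i => if f i <= g i then g i else f i].

Definition min_fun f g : {ffun 'I_n -> 'I_3} :=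
  [ffun i => if f i <= g i then f i else g i].

Definition zero_fun f : {ffun 'I_n -> 'I_3} :=
  [ffun i => if (f i == 1 :> nat) && [exists j : 'I_n, (j < i) && (f j == 0 :> nat)]
             then ord0 else f i].

Lemma join_funE f g i : join_fun f g i = maxn (f i) (g i) :> nat.
Proof. by rewrite ffunE; case: leqP. Qed.

Lemma min_funE f g i : min_fun f g i = minn (f i) (g i) :> nat.
Proof. by rewrite ffunE; case: leqP. Qed.

Lemma zero_fun_le f i : zero_fun f i <= f i.
Proof. by rewrite ffunE; case: ifP. Qed.

Lemma join_fun_tri u v : is_triword (join_fun u v).
Proof.
have /is_triwordP[u1 u2] := triwordP u; have /is_triwordP[v1 v2] := triwordP v.
apply/is_triwordP; split=> [i /[dup] /u1 ui /v1 vi|i j]; rewrite !join_funE.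
  by rewrite /maxn; case: ifP.
move=> /eqP; rewrite -leqn0 geq_max !leqn0 => /andP[/eqP ui /eqP vi] ij.
by have := u2 i j ui ij; have := v2 i j vi ij; rewrite /maxn; case: ifP.
Qed.

Lemma meet_fun_tri u v : is_triword (zero_fun (min_fun u v)).
Proof.
have /is_triwordP[u1 _] := triwordP u.
apply/is_triwordP; split=> [i i0 zi|i j].
  have : zero_fun (min_fun u v) i <= u i.
    by apply: leq_trans (zero_fun_le _ _) _; rewrite min_funE geq_minl.
  by rewrite zi; have := u1 i i0; case: (u i) => -[|[|[|]]].
move: (min_fun u v) => m; rewrite !ffunE => zi ij.
have [k kj mk] : exists2 k : 'I_n, k < j & m k = 0 :> nat.
  move: zi; case: ifP => [/andP[_ /existsP[k /andP[ki /eqP mk]]] _|_ mi].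
    by exists k => //; apply: ltn_trans ij.
  by exists i.
case: ifP => // /negbT; rewrite negb_and => /orP[/eqP//|/existsPn/(_ k)].
by rewrite kj mk.
Qed.

Definition tri_join u v : triword n := Triword (join_fun_tri u v).
Definition tri_meet u v : triword n := Triword (meet_fun_tri u v).

Lemma tri_le_meet u v w : tri_le u (tri_meet v w) = tri_le u v && tri_le u w.
Proof.
apply/tri_leP/andP => [H|[/tri_leP uv /tri_leP uw] i].
  by split; apply/tri_leP=> i; apply: leq_trans (H i) _;
     apply: leq_trans (zero_fun_le _ _) _; rewrite min_funE ?geq_minl ?geq_minr.
have um j : u j <= min_fun v w j by rewrite min_funE leq_min uv uw.
have /is_triwordP[_ u2] := triwordP u.
rewrite /= ffunE; case: ifP => // /andP[/eqP mi /existsP[j /andP[ji /eqP mj]]].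
have uj : u j = 0 :> nat by apply/eqP; rewrite -leqn0; move: (um j); rewrite mj.
by have := u2 j i uj ji; have := um i; rewrite mi; case: (u i) => -[|[|]].
Qed.

Lemma tri_le_join u v w : tri_le (tri_join u v) w = tri_le u w && tri_le v w.
Proof.
apply/tri_leP/andP => [H|[/tri_leP uw /tri_leP vw] i].
  by split; apply/tri_leP=> i; have := H i; rewrite /= join_funE geq_max
     => /andP[].
by rewrite /= join_funE geq_max uw vw.
Qed.

HB.instance Definition _ :=
  Order.POrder_MeetJoin_isLattice.Build triword_display (triword n)
    tri_le_meet tri_le_join.

Lemma bot_fun_tri : is_triword [ffun _ : 'I_n => ord0].
Proof. by apply/is_triwordP; split=> [i _|i j _ _]; rewrite !ffunE. Qed.

Lemma top_fun_tri :
  is_triword [ffun i : 'I_n => if i == 0 :> nat then inord 1 else inord 2].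
Proof.
apply/is_triwordP; split=> [i|i j]; rewrite !ffunE.
  by move=> ->; rewrite eqxx inordK.
by case: ifP => _; rewrite inordK.
Qed.

Definition tri_bot : triword n := Triword bot_fun_tri.
Definition tri_top : triword n := Triword top_fun_tri.

Lemma tri_bot_le u : tri_le tri_bot u.
Proof. by apply/tri_leP=> i; rewrite /= ffunE. Qed.

Lemma tri_le_top u : tri_le u tri_top.
Proof.
have /is_triwordP[u1 _] := triwordP u.
apply/tri_leP=> i; rewrite /= ffunE.
by case: eqP => [/u1|_]; rewrite inordK //; case: (u i) => -[|[|[|]]].
Qed.

HB.instance Definition _ :=
  Order.hasBottom.Build triword_display (triword n) tri_bot_le.
HB.instance Definition _ :=
  Order.hasTop.Build triword_display (triword n) tri_le_top.

Lemma triword_leE u v : (u <= v)%O = [forall i, u i <= v i].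
Proof. by []. Qed.

Lemma triword_joinE u v i : (u `|` v)%O i = maxn (u i) (v i) :> nat.
Proof. exact: join_funE. Qed.

Lemma triword_meetE u v i :
  (u `&` v)%O i =
    (if (minn (u i) (v i) == 1) &&
        [exists j : 'I_n, (j < i) && (minn (u j) (v j) == 0)]
     then 0 else minn (u i) (v i)) :> nat.
Proof.
rewrite [LHS]/= ffunE min_funE.
under eq_existsb => j do rewrite min_funE.
by case: ifP => // _; rewrite min_funE.
Qed.

Lemma triword_bottomE i : (\bot%O : triword n) i = 0 :> nat.
Proof. by rewrite /= ffunE. Qed.

End Hochschild.

Definition hochschild (n : nat) : finTBLatticeType triword_display := triword n.

(* Main.v *)
Require Import Defs.
From mathcomp Require Import all_boot all_order.

(** The join-irreducibles of [Hoch(n)] are the words [a_i = 1..10..0] (last 1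
    at position [i]) and [b_j = 0..020..0] (a 2 at position [j > 0], counting
    from 0).  The facets of the canonical join complex are the sets
    [{a_i} U {b_j : j <> i}]: two words [a_i] are comparable, and [a_i] and
    [b_i] exclude each other because [a_(i-1) \/ b_i = a_i \/ b_i].  Removing
    the vertices [a_i] with [i > 0] one by one is a shedding order: the link of
    [a_i] is the simplex on [{b_j : j <> i}], which lies strictly inside the
    facet [{a_0} U {b_j : j > 0}], and the latter is all that remains. *)

Set Implicit Arguments.
Unset Strict Implicit.
Unset Printing Implicit Defensive.

Import Order.TTheory.

(** * Vertex decomposability of a simplex with cones attached to proper faces *)

Section SheddingOfSimplices.
Variables (T I : finType) (P : {set T}) (v : I -> T) (c : I -> {set T}).
Hypothesis v_inj : injective v.
Hypothesis vP : forall i, v i \notin P.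
Hypothesis cP : forall i, c i \proper P.

(** The simplex on [P] with, for each [i] in [S], a cone of apex [v i] glued along the face [c i] of
    [P]. The set [S] of apexes still present is what the shedding shrinks. *)
Definition star_complex (S : {set I}) : {set {set T}} :=
  [set F : {set T} | (F \subset P) || [exists i in S, F \subset v i |: c i]].

Lemma facet_powerset (Q F : {set T}) : facet (powerset Q) F = (F == Q).
Proof.
rewrite /facet; apply/maxsetP/eqP => [[]|->].
  by rewrite /= inE => sFQ /(_ Q); rewrite /= inE => ->.
split; first by rewrite /= inE.
by move=> G; rewrite /= inE => sGQ sQG; apply/eqP; rewrite eqEsubset sGQ.
Qed.

Lemma vertex_decomposable_powerset (Q : {set T}) :
  vertex_decomposable (powerset Q).
Proof.
apply: VD_simplex; exists Q; split; first by rewrite facet_powerset.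
by move=> F; rewrite facet_powerset => /eqP.
Qed.

Lemma notin_c i k : v i \notin c k.
Proof. exact: contra (subsetP (proper_sub (cP k)) _) (vP i). Qed.

Lemma star_complex0 : star_complex set0 = powerset P.
Proof.
apply/setP=> F; rewrite !inE; case: (F \subset P) => //=.
by apply/exists_inP=> -[i]; rewrite inE.
Qed.

Lemma del_star_complex S i : del (star_complex S) (v i) = star_complex (S :\ i).
Proof.
apply/setP=> F; rewrite !inE; apply/andP/orP.
  case=> /orP[->|/exists_inP[k kS sF]] vF; first by left.
  case: (eqVneq k i) => [ki|ki]; last first.
    by right; apply/exists_inP; exists k => //; rewrite !inE ki.
  left; apply: subset_trans (proper_sub (cP k)); apply/subsetP=> x xF.
  have := subsetP sF x xF; rewrite !inE => /orP[/eqP xk|//].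
  by rewrite -ki -xk xF in vF.
case=> [sFP|/exists_inP[k]].
  by rewrite sFP; split=> //; apply: contra (subsetP sFP _) (vP i).
rewrite !inE => /andP[ki kS] sF; split.
  by apply/orP; right; apply/exists_inP; exists k.
apply/negP=> /(subsetP sF); rewrite !inE (negPf (notin_c _ _)) orbF.
by move=> /eqP/v_inj ik; rewrite ik eqxx in ki.
Qed.

(** The apex [v i] lies outside [P] and, [v] being injective, in no cone but its own, so only that
    cone contributes to the link. *)
Lemma link_star_complex (S : {set I}) i :
  i \in S -> link (star_complex S) (v i) = powerset (c i).
Proof.
move=> iS; apply/setP=> F; rewrite !inE; apply/idP/idP.
  case/and3P=> _ vF /orP[sF|/exists_inP[k kS sF]].
    by have := subsetP sF (v i) (setU11 _ _); rewrite (negPf (vP i)).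
  have := subsetP sF (v i) (setU11 _ _).
  rewrite !inE (negPf (notin_c _ _)) orbF => /eqP/v_inj ik; subst k.
  apply/subsetP=> x xF; have := subsetP sF x.
  rewrite !inE xF orbT => /(_ isT)/orP[/eqP xi|//].
  by rewrite -xi xF in vF.
move=> sF; apply/and3P; split.
- by rewrite (subset_trans sF (proper_sub (cP i))).
- by apply: contra (subsetP sF _) (notin_c i i).
by apply/orP; right; apply/exists_inP; exists i => //; apply: setUS.
Qed.

Lemma vertex_decomposable_star_complex S : vertex_decomposable (star_complex S).
Proof.
have [k] := ubnP #|S|; elim: k S => // k IHk S.
case: (set_0Vmem S) => [->|[i iS]] ltSk.
  by rewrite star_complex0; apply: vertex_decomposable_powerset.
apply: (@VD_shedding _ _ (v i)).
- rewrite /vertex inE; apply/orP; right; apply/exists_inP; exists i => //.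
  by rewrite sub1set setU11.
- by rewrite link_star_complex //; apply: vertex_decomposable_powerset.
- by rewrite del_star_complex; apply: IHk; rewrite (cardsD1 i) iS in ltSk.
move=> F; rewrite link_star_complex // facet_powerset => /eqP->.
(* (VD3): the only facet [c i] of the link lies strictly inside [P], a face of the deletion. *)
rewrite del_star_complex; apply/negP=> /maxsetP[_ /(_ P)].
rewrite !inE subxx => /(_ isT (proper_sub (cP i))) Pc.
by have := cP i; rewrite -Pc properxx.
Qed.

End SheddingOfSimplices.

Section CanonicalJoinComplexTheory.
Context {d : Order.disp_t} {L : finTBLatticeType d}.
Local Open Scope order_scope.

Lemma canonical_join_representation_join (A : {set L}) :
  A \in canonical_join_complex L ->
  canonical_join_representation A (\join_(x in A) x).
Proof.
rewrite inE => /existsP[a Aa].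
by have /canonical_join_representationP[_ /eqP-> _] := Aa.
Qed.

End CanonicalJoinComplexTheory.

(** * The join-irreducible triwords and their order *)

Section Hochschild.
Variable n : nat.
Implicit Types (u v : hochschild n) (i j k : 'I_n) (A F : {set hochschild n}).

Lemma ones_fun_tri i :
  is_triword [ffun j : 'I_n => if j <= i then inord 1 else ord0 : 'I_3].
Proof.
apply/is_triwordP; split=> [j _|j k]; rewrite !ffunE.
  by case: ifP; rewrite ?inordK.
case: (leqP j i) => [_|ij _ jk]; first by rewrite inordK.
by rewrite leqNgt (ltn_trans ij jk).
Qed.

(* The conjunct [0 < i] makes [two 0] the bottom word, since a triword cannot
   start with a 2. *)
Lemma two_fun_tri i :
  is_triword [ffun j : 'I_n => if (j == i) && (0 < i) then inord 2 else ord0 : 'I_3].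
Proof.
apply/is_triwordP; split=> [j j0|j k _ _]; rewrite !ffunE; case: ifP => //.
  by move=> /andP[/eqP<-]; rewrite j0.
by rewrite inordK.
Qed.

Definition ones i : hochschild n := Triword (ones_fun_tri i).
Definition two i : hochschild n := Triword (two_fun_tri i).

Lemma onesE i j : ones i j = (j <= i) :> nat.
Proof. by rewrite /= ffunE; case: leqP => // _; rewrite inordK. Qed.

Lemma twoE i j : two i j = ((j == i) && (0 < i)).*2 :> nat.
Proof. by rewrite /= ffunE; case: ifP => // _; rewrite inordK. Qed.

Lemma letter_le2 u i : u i <= 2.
Proof. by rewrite -ltnS ltn_ord. Qed.

(** By (T3) no 0 stands to the left of a 1, so the letters of [u] up to [i] are all positive. *)
Lemma ones_le i u : u i = 1 :> nat -> (ones i <= u)%O.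
Proof.
have /is_triwordP[_ u2] := triwordP u => ui.
rewrite triword_leE; apply/forallP=> j; rewrite onesE.
case: (leqP j i) => // ji; rewrite lt0n; apply/eqP=> uj.
case: (ltngtP j i) ji => // [ji _|/val_inj ji _]; first exact: (u2 j i).
by rewrite ji ui in uj.
Qed.

Lemma two_le i u : u i = 2 :> nat -> (two i <= u)%O.
Proof.
move=> ui; rewrite triword_leE; apply/forallP=> j; rewrite twoE.
by case: eqP => // ->; rewrite ui; case: (0 < i).
Qed.

Lemma letter2_gt0 u i : u i = 2 :> nat -> 0 < i.
Proof.
have /is_triwordP[u1 _] := triwordP u => ui.
by rewrite lt0n; apply/eqP=> /u1.
Qed.

Lemma ones_mono i j : (ones i <= ones j)%O = (i <= j).
Proof.
rewrite triword_leE; apply/forallP/idP => [/(_ i)|ij k].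
  by rewrite !onesE leqnn; case: (i <= j).
by rewrite !onesE; case: (leqP k i) => // ki; rewrite (leq_trans ki ij).
Qed.

Lemma ones_inj : injective ones.
Proof.
by move=> i j eij; apply/val_inj/eqP; rewrite eqn_leq -!ones_mono eij lexx.
Qed.

Lemma ones_le_two i j : (ones i <= two j)%O = false.
Proof.
apply/negP; rewrite triword_leE => /forallP H.
(* Position 0 separates the two words: [ones i] has a 1 there, [two j] a 0, even for [j] of value
   0. *)
have n0 : 0 < n by apply: leq_ltn_trans (ltn_ord i).
have := H (Ordinal n0); rewrite onesE twoE /= -val_eqE /=.
by case: (val j).
Qed.

Lemma two_le_ones i j : 0 < i -> (two i <= ones j)%O = false.
Proof.
move=> i0; apply/negP; rewrite triword_leE => /forallP/(_ i).
by rewrite onesE twoE eqxx i0; case: (i <= j).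
Qed.

Lemma two_le_two i j : 0 < i -> (two i <= two j)%O -> i = j.
Proof.
move=> i0; rewrite triword_leE => /forallP/(_ i).
by rewrite !twoE eqxx i0; case: eqP.
Qed.

(** * Joins read letter by letter, and restrictions on faces *)

Lemma join_letter A i : (\join_(x in A) x)%O i = \max_(x in A) x i :> nat.
Proof.
apply: (big_morph (fun u => val (u i))); last exact: triword_bottomE.
by move=> u v; exact: triword_joinE.
Qed.

(** A nonempty maximum is attained; [0 < m] excludes the empty join, whose letters are all 0. *)
Lemma join_letter_attained A i m : 0 < m ->
  (\join_(x in A) x)%O i = m :> nat -> exists2 x, x \in A & x i = m :> nat.
Proof.
rewrite join_letter => m0.
have [->|[x xA]] := set_0Vmem A; first by rewrite big_set0 => m_0; rewrite -m_0 in m0.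
have A0 : 0 < #|A| by apply/card_gt0P; exists x.
by case: (eq_bigmax_cond (fun u : hochschild n => val (u i)) A0) => y yA -> <-; exists y.
Qed.

(** In general a redundant join representation of [u], since the words [ones i] form a chain. It
    serves as a test: a canonical representation of [u] has to refine it. *)
Definition components u : {set hochschild n} :=
  [set ones i | i : 'I_n & u i == 1 :> nat] :|:
  [set two i | i : 'I_n & u i == 2 :> nat].

Lemma join_components u : join_representation (components u) u.
Proof.
apply/eqP/le_anti/andP; split.
  apply/joinsP=> x; rewrite inE => /orP[]/imsetP[i]; rewrite inE => /eqP ui ->.
    exact: ones_le.
  exact: two_le.
have le_join x : x \in components u ->
    forall i, x i <= (\join_(y in components u) y)%O i.
  by move=> xu; apply/forallP; rewrite -triword_leE; apply: joins_sup.
rewrite triword_leE; apply/forallP=> i.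
case E : (val (u i)) (letter_le2 u i) => [|[|[|//]]] _ //.
  have /le_join/(_ i) : ones i \in components u.
    by rewrite inE imset_f // inE E.
  by rewrite onesE leqnn.
have /le_join/(_ i) : two i \in components u.
  by rewrite inE orbC imset_f // inE E.
by rewrite twoE eqxx (letter2_gt0 E).
Qed.

Lemma componentsP u x : x \in components u ->
  (exists2 i, u i = 1 :> nat & x = ones i) \/
  (exists2 i, u i = 2 :> nat & x = two i).
Proof.
by rewrite inE => /orP[]/imsetP[i]; rewrite inE => /eqP ui ->; [left|right];
  exists i.
Qed.

Lemma components_le u x : x \in components u -> (x <= u)%O.
Proof. by case/componentsP=> -[i ui ->]; [apply: ones_le|apply: two_le]. Qed.

(** The singleton of [x] is again canonical, hence refines [components x]; as components of [x] are
    below [x], one of them equals [x]. *)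
Lemma canonical_vertexP F x : F \in canonical_join_complex (hochschild n) ->
  x \in F -> (exists i, x = ones i) \/ (exists2 i : 'I_n, 0 < i & x = two i).
Proof.
move=> FD xF; have xD : [set x] \in canonical_join_complex (hochschild n).
  by apply: canonical_join_complexS FD _; rewrite sub1set.
have := canonical_join_representation_join xD; rewrite big_set1.
case/canonical_join_representationP=> _ _ /(_ _ (join_components x)).
move=> /refinesP/(_ x (set11 x))[y yx xy].
have {xy} -> : x = y by apply/le_anti; rewrite xy components_le.
case/componentsP: yx => -[i xi ->]; first by left; exists i.
by right; exists i => //; apply: letter2_gt0 xi.
Qed.

(** The join has letter 2 at [i], 1 before it and 0 after it. Refining its components would put
    [ones i] below some [ones k] with letter 1 at [k], which forces [k < i]. *)
Lemma ones_two_not_face i : 0 < i ->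
  [set ones i; two i] \notin canonical_join_complex (hochschild n).
Proof.
move=> i0; apply/negP=> /canonical_join_representation_join.
rewrite joins_setU !big_set1.
case/canonical_join_representationP=> _ _ /(_ _ (join_components _)).
move=> /refinesP/(_ (ones i) (set21 _ _))[y].
case/componentsP=> -[k yk ->]; last by rewrite ones_le_two.
rewrite ones_mono leq_eqVlt => /orP[/eqP/val_inj ik|ik].
  by move: yk; rewrite triword_joinE -ik onesE twoE eqxx i0 leqnn.
move: yk; rewrite triword_joinE onesE twoE leqNgt ik /=.
by case: eqP ik => // ->; rewrite ltnn.
Qed.

(** * The facets of the canonical join complex *)

Definition twos i : {set hochschild n} :=
  [set two j | j : 'I_n & (j != i) && (0 < j)].

Lemma twosP i x :
  reflect (exists j : 'I_n, [/\ j != i, 0 < j & x = two j]) (x \in twos i).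
Proof.
apply: (iffP imsetP) => [[j]|[j [ji j0 ->]]].
  by rewrite inE => /andP[ji j0] ->; exists j.
by exists j => //; rewrite inE ji.
Qed.

Lemma join_ones_twos i j : (\join_(x in ones i |: twos i) x)%O j =
  (if j == i then 1 else if 0 < j then 2 else 1) :> nat.
Proof.
rewrite joins_setU big_set1 triword_joinE onesE join_letter.
have -> : \max_(x in twos i) x j = ((j != i) && (0 < j)).*2; last first.
  case: (eqVneq j i) => [->|ji] /=; first by rewrite leqnn.
  case: (ltnP 0 j) => j0 /=; first by case: leqP.
  by rewrite (leq_trans j0).
apply/eqP; rewrite eqn_leq; apply/andP; split.
  apply/bigmax_leqP=> x /twosP[k [ki k0 ->]]; rewrite twoE k0 andbT.
  by case: eqP => // ->; rewrite ki k0.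
case: andP => // -[ji j0].
have jt : two j \in twos i by apply/twosP; exists j.
by apply: leq_trans (leq_bigmax_cond _ jt); rewrite twoE eqxx j0.
Qed.

(** The join has letter 1 at [i] and 2 at each [j] with [two j] in [twos i]. Any representation
    attains these letters in some member, which then lies above [ones i] or [two j] respectively. *)
Lemma ones_twos_face i :
  ones i |: twos i \in canonical_join_complex (hochschild n).
Proof.
rewrite inE; apply/existsP; exists (\join_(x in ones i |: twos i) x)%O.
apply/canonical_join_representationP; split.
- apply/antichainP=> x y.
  move=> /setU1P[->|/twosP[j [_ j0 ->]]] /setU1P[->|/twosP[k [_ k0 ->]]] //.
  + by rewrite ones_le_two.
  + by rewrite two_le_ones.
  + by move=> /(two_le_two j0)->.
- exact: eqxx.
move=> B /eqP EB; apply/refinesP=> x /setU1P[->|/twosP[j [ji j0 ->]]].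
  have : (\join_(x in B) x)%O i = 1 :> nat by rewrite EB join_ones_twos eqxx.
  by case/join_letter_attained=> // y yB /ones_le; exists y.
have : (\join_(x in B) x)%O j = 2 :> nat.
  by rewrite EB join_ones_twos (negPf ji) j0.
by case/join_letter_attained=> // y yB /two_le; exists y.
Qed.

Lemma canonical_join_complex_hochschildP F : 0 < n ->
  reflect (exists i, F \subset ones i |: twos i)
          (F \in canonical_join_complex (hochschild n)).
Proof.
move=> n0; apply: (iffP idP) => [FD|[i]]; last first.
  exact: canonical_join_complexS (ones_twos_face i).
have /canonical_join_representation_join := FD.
case/canonical_join_representationP=> /antichainP FA _ _.
case: (pickP (fun i => ones i \in F)) => [i iF|noF].
  exists i; apply/subsetP=> x xF; rewrite inE in_set1.
  case: (canonical_vertexP FD xF) => [[k xk]|[j j0 xj]].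
    apply/orP; left; apply/eqP; move: xF; rewrite xk => kF.
    case: (leqP k i) => [ki|/ltnW ik]; first by apply: FA => //; rewrite ones_mono.
    by apply/esym/FA => //; rewrite ones_mono.
  apply/orP; right; apply/twosP; exists j; split=> //; apply/eqP=> ji.
  have /negP[] := ones_two_not_face j0; apply: canonical_join_complexS FD _.
  by rewrite subUset !sub1set -xj xF ji iF.
(* With no [ones] in [F], position 0 is a good index: its [twos] contains every [two j] with
   [0 < j]. *)
exists (Ordinal n0); apply/subsetP=> x xF; rewrite inE.
case: (canonical_vertexP FD xF) => [[k xk]|[j j0 xj]].
  by rewrite xk noF in xF.
apply/orP; right; apply/twosP; exists j; split=> //.
by rewrite -val_eqE -lt0n.
Qed.

End Hochschild.

Theorem theorem1p2 (n : nat) (n_gt0 : 0 < n) :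
  vertex_decomposable (canonical_join_complex (hochschild n)).
Proof.
pose o := Ordinal n_gt0.
(* The index [o] is left out because [ones o] already belongs to the base simplex [P], while apexes
   must lie outside it. *)
pose I := {i : 'I_n | i != o}.
pose P := ones o |: twos o.
have onesP i : ones i \in P -> i = o.
  case/setU1P=> [/ones_inj//|/twosP[j [_ _ ij]]].
  by have := ones_le_two i j; rewrite -ij lexx.
have vP (i : I) : ones (val i) \notin P.
  by apply/negP=> /onesP io; have := valP i; rewrite io eqxx.
have cP (i : I) : twos (val i) \proper P.
  apply/properP; split.
    apply/subsetP=> x /twosP[j [_ j0 ->]]; apply/setU1P; right.
    by apply/twosP; exists j; split=> //; rewrite -val_eqE -lt0n.
  exists (ones o); first exact: setU11.
  apply/negP=> /twosP[j [_ _ ij]].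
  by have := ones_le_two o j; rewrite -ij lexx.
have v_inj : injective (fun i : I => ones (val i)).
  by move=> i j /ones_inj/val_inj.
have -> : canonical_join_complex (hochschild n) =
    star_complex P (fun i : I => ones (val i)) (fun i => twos (val i)) setT.
  apply/setP=> F; rewrite [RHS]inE.
  apply/canonical_join_complex_hochschildP/orP => // [[i sF]|].
    case: (eqVneq i o) => [io|io]; first by left; rewrite /P -io.
    by right; apply/exists_inP; exists (exist _ i io).
  by case=> [sF|/exists_inP[i _ sF]]; [exists o|exists (val i)].
exact: vertex_decomposable_star_complex.
Qed.
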